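(* For every integer $d\ge 2$ there is $C_d>0$ such that for every positive integer $n$, $M_d(n)\le 2^{n^{C_d n^{d-1}}}$.
   Context: A $d$-dimensional array is an injective function $f:A_1\times\dots\times A_d\to\mathbb{R}$, where $A_1,\dots,A_d$ are non-empty subsets of $\mathbb{Z}$. If $|A_i|=n$ for each $i$, the array is said to have size $[n]^d$. A subarray of $f$ is a restriction of $f$ to $B_1\times\dots\times B_d$ with non-empty $B_i\subseteq A_i$. A $d$-dimensional array $f$ is monotone if for every $i\in\{1,\dots,d\}$ one of the following holds: (1) for every choice of $a_j\in A_j$, $j\ne i$, the function $x\mapsto f(a_1,\dots,a_{i-1},x,a_{i+1},\dots,a_d)$ is increasing in $x\in A_i$; or (2) for every choice of $a_j\in A_j$, $j\neq i$, this function is decreasing in $x\in A_i$. With $[N]=\{1,\dots,N\}$, $M_d(n)$ denotes the smallest $N$ such that every $d$-dimensional array on $[N]^d$ contains a monotone $d$-dimensional subarray of size $[n]^d$. *)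

(* Defs.v *)
From mathcomp Require Import all_boot all_order all_algebra.
From mathcomp Require Import all_classical all_reals all_analysis.
Set Implicit Arguments.
Unset Strict Implicit.
Unset Printing Implicit Defensive.
Import Order.TTheory GRing.Theory Num.Theory.
Local Open Scope classical_set_scope.
Local Open Scope card_scope.
Local Open Scope ring_scope.

Definition box (d : nat) (A : 'I_d -> set int) : set ('I_d -> int) :=
  [set x | forall i, A i (x i)].

(* [array_fun] is total, but only its values on [box array_dom] are
   meaningful: no definition below looks at the others. *)
Record array (R : realType) (d : nat) := Array {
  array_dom : 'I_d -> set int;
  array_fun :> ('I_d -> int) -> R;
  array_dom_nonempty : forall i, array_dom i !=set0;
  array_inj : {in box array_dom &, injective array_fun}
}.

Definition has_size (R : realType) (d : nat) (f : array R d) (n : nat) : Prop :=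
  forall i, array_dom f i #= `I_n.

Definition subarray (R : realType) (d : nat) (g f : array R d) : Prop :=
  (forall i, array_dom g i `<=` array_dom f i) /\
  {in box (array_dom g), g =1 f}.

(* [dfwith a i x] is [a] with its [i]-th coordinate replaced by [x]. *)
Definition increasing_along (R : realType) (d : nat) (f : array R d)
    (i : 'I_d) : Prop :=
  forall a : 'I_d -> int, (forall j, j != i -> array_dom f j (a j)) ->
  {in array_dom f i &, {homo (fun x : int => f (dfwith a i x)) :
     x y / x < y >-> x < y}}.

Definition decreasing_along (R : realType) (d : nat) (f : array R d)
    (i : 'I_d) : Prop :=
  forall a : 'I_d -> int, (forall j, j != i -> array_dom f j (a j)) ->
  {in array_dom f i &, {homo (fun x : int => f (dfwith a i x)) :
     x y / x < y >-> y < x}}.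

Definition monotone_array (R : realType) (d : nat) (f : array R d) : Prop :=
  forall i, increasing_along f i \/ decreasing_along f i.

(* Positivity of [N] is required because there is no array on the empty
   [0]^d, so the condition would hold vacuously for [N = 0]. *)
Definition forces_monotone (R : realType) (d n N : nat) : Prop :=
  (0 < N)%N /\
  forall f : array R d,
    (forall i, array_dom f i = [set k : int | 1 <= k <= N%:Z]) ->
    exists g : array R d,
      [/\ subarray g f, has_size g n & monotone_array g].

(* [is_M R d n N] means that M_d(n) exists and equals [N]. *)
Definition is_M (R : realType) (d n N : nat) : Prop :=
  forces_monotone R d n N /\
  forall N' : nat, forces_monotone R d n N' -> (N <= N')%N.

(* Main.v *)
Require Import Defs.
From mathcomp Require Import all_boot all_order all_algebra.
From mathcomp Require Import all_classical all_reals all_analysis.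
From mathcomp Require Import zify.
Import Order.TTheory GRing.Theory Num.Theory.
Set Implicit Arguments.
Unset Strict Implicit.

(** Let f be an array on [N]^d.  Fixing the other coordinates of a point gives
    a function of one coordinate, which Erdős-Szekeres makes monotone on n of
    any n^2 of its arguments; the difficulty is to choose one set of arguments
    and one direction that work on all the parallel lines at once, for every
    axis, without paying an exponential for each axis.

    The bound spends its outer exponential once, in [homogenize].  Peel the
    coordinates off one at a time, and for each value x of the first one take,
    by induction, a good subbox of side t of the slice f(x, -).  There are few
    pairs (subbox, order pattern of the slice on it), so if N >= 2^(t^((d+1)^2))
    the same pair occurs for t values of x.  On the resulting box of side t all
    slices f(x, -) are order isomorphic; so, recursively, whether f goes up or
    down along an edge in direction i does not depend on the coordinates
    before i.

    After that, polynomial losses suffice ([monotone_in_dense]).  Suppose that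
    the points of the final box must lie in a set P of density 1/a.  Take
    L = 4 a n^2 values of the first coordinate over which P is dense.  Over a
    positive proportion of the remaining coordinates q, at least n^2 of these L
    values x satisfy (x, q) in P, hence n of them form a monotone sequence; at
    most 2 L^n pairs (n values, direction) are possible, so some pair serves
    all q in a set P' of density about 1/(a L^n) ([thin_direction]).  The first
    direction is now settled over the whole of P', and by homogeneity the other
    directions need only be settled in a single slice, where the induction
    continues with P' in place of P.

    Starting from a = n^4, which is large enough to absorb the constants, each
    axis multiplies the exponent of n in a by at most 3n, so d axes are possible
    once t = n^(16 (3n)^(d-1)), which is n^(O(n^(d-1))); then N = 2^(t^((d+1)^2))
    has the required form. *)

(** * Increasing maps and pigeonhole *)

Definition increasing m N (s : 'I_m -> 'I_N) := forall x y : 'I_m, x < y -> s x < s y.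

Definition lt_dir disp (T : orderType disp) (e : bool) (x y : T) : bool :=
  if e then (x < y)%O else (y < x)%O.

Lemma increasing_into m N (A : {set 'I_N}) : m <= #|A| ->
  exists s : {ffun 'I_m -> 'I_N}, increasing s /\ forall x, s x \in A.
Proof.
move=> mA; exists [ffun x => enum_val (widen_ord mA x)]; split=> [x y xy|x];
  last by rewrite ffunE enum_valP.
rewrite !ffunE.
have sA : sorted (relpre val ltn) (enum A).
  rewrite /enum_mem; apply: sorted_filter; first by move=> ? ? ?; apply: ltn_trans.
  by rewrite -sorted_map -enumT val_enum_ord iota_ltn_sorted.
have yA : y < size (enum A) by rewrite -cardE (leq_trans _ mA).
pose z0 := enum_val (widen_ord mA x).
have valE z : enum_val (widen_ord mA z) = nth z0 (enum A) z.
  by apply: set_nth_default; rewrite -cardE; apply: leq_trans (ltn_ord z) mA.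
rewrite !valE; apply: (sorted_ltn_nth _ z0 sA x y) => //.
- by move=> ? ? ?; apply: ltn_trans.
- by rewrite inE (ltn_trans xy yA).
Qed.

Lemma popular_colour (X C : finType) (A : {set X}) (col : X -> C) : 0 < #|A| ->
  exists c, #|A| <= #|C| * #|[set x in A | col x == c]|.
Proof.
move=> /card_gt0P [x0 _].
have [c _ cmax] := arg_maxnP (fun c => #|[set x in A | col x == c]|) (erefl : xpredT (col x0)).
exists c; rewrite -sum_nat_const.
have -> : #|A| = \sum_(c : C) #|[set x in A | col x == c]|.
  rewrite -sum1_card (partition_big col xpredT) //=.
  by apply: eq_bigr => c' _; rewrite -sum1dep_card; apply: eq_bigl.
by apply: leq_sum => c' _; apply: cmax.
Qed.

(** A weight that is bounded by [D] and has average at least [D / a] must be at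
    least [D / (2 a)] on a proportion [1 / (2 a)] of the points: the lighter
    points account for at most half of the total. *)
Lemma heavy_points (X : finType) (w : X -> nat) D a :
  0 < D -> (forall x, w x <= D) -> #|X| * D <= a * \sum_x w x ->
  #|X| <= 2 * a * #|[set x | D <= 2 * a * w x]|.
Proof.
move=> D0 wD dens; set H := [set x | _].
have : 2 * a * \sum_x w x <= 2 * a * (#|H| * D) + #|X| * D.
  rewrite (bigID (mem H)) /= mulnDr leq_add //.
    rewrite leq_mul2l -sum_nat_const; apply/orP; right.
    by apply: leq_sum.
  rewrite big_distrr /= -sum_nat_const big_mkcond /=; apply: leq_sum => x _.
  by case: ifP => //; rewrite inE -ltnNge => /ltnW.
move=> h; have : #|X| * D <= 2 * a * #|H| * D by lia.
by rewrite leq_pmul2r.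
Qed.

(** * The Erdős-Szekeres theorem *)

(** The points of [A] that have no point of [A] both before and below them form
    a decreasing sequence [M].  If [M] is short, removing it leaves enough
    points to find an increasing sequence one shorter, whose first point is not
    in [M] and so can be preceded by another point of [A]. *)
Lemma chain_dichotomy disp (T : orderType disp) L (h : 'I_L -> T) p q (A : {set 'I_L}) :
  injective h -> p * q < #|A| ->
  (exists S : {set 'I_L}, [/\ S \subset A, p < #|S| &
     {in S &, forall x y : 'I_L, x < y -> lt_dir true (h x) (h y)}]) \/
  (exists S : {set 'I_L}, [/\ S \subset A, q < #|S| &
     {in S &, forall x y : 'I_L, x < y -> lt_dir false (h x) (h y)}]).
Proof.
move=> hinj; elim: p A => [|p IH] A.
  move=> /card_gt0P[x xA]; left; exists [set x]; split; rewrite ?finset.sub1set ?cards1 //.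
  by move=> y z; rewrite !inE => /eqP-> /eqP->; rewrite ltnn.
move=> cA.
pose M := [set x in A | [forall y in A, (y < x) ==> (h x < h y)%O]].
have MA : M \subset A by apply/fintype.subsetP => x; rewrite inE => /andP[].
have [qM|Mq] := ltnP q #|M|.
  right; exists M; split=> // x y; rewrite !inE /lt_dir /=.
  by move=> /andP[xA _] /andP[_ /forall_inP/(_ x xA)/implyP].
have /IH[[S [SA pS incS]]|[S [SA qS decS]]] : p * q < #|A :\: M|.
- by rewrite cardsD (finset.setIidPr MA); lia.
- left.
  have /card_gt0P[s0 s0S] : 0 < #|S| by apply: leq_trans pS.
  have [x xS xmin] := arg_minnP (fun i : 'I_L => i : nat) s0S.
  have : x \in A :\: M by apply: (fintype.subsetP SA).
  rewrite !inE => /andP[+ xA]; rewrite xA /= negb_forall => /existsP[y].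
  rewrite negb_imply negb_imply => /andP[yA /andP[yx]]; rewrite -leNgt => hyx.
  have {hyx} hyx : (h y < h x)%O.
    rewrite lt_neqAle hyx andbT; apply/eqP => /hinj E.
    by rewrite E ltnn in yx.
  have yS : y \notin S by apply/negP => /xmin; rewrite leqNgt yx.
  exists (y |: S); split.
  + by rewrite finset.subUset finset.sub1set yA (fintype.subset_trans SA) // finset.subsetDl.
  + by rewrite cardsU1 yS.
  + move=> u v; rewrite !inE => /orP[/eqP->|uS] /orP[/eqP->|vS].
    * by rewrite ltnn.
    * move=> _; rewrite /lt_dir; have := xmin _ vS; rewrite leq_eqVlt => /orP[/eqP E|xv].
        by rewrite -(val_inj E).
      exact: lt_trans hyx (incS _ _ xS vS xv).
    * by move=> uy; have := xmin _ uS; rewrite leqNgt (ltn_trans uy yx).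
    * exact: incS.
- right; exists S; split=> //.
  by rewrite (fintype.subset_trans SA) // finset.subsetDl.
Qed.

Lemma erdos_szekeres disp (T : orderType disp) L (h : 'I_L -> T) n (A : {set 'I_L}) :
  injective h -> 0 < n -> n ^ 2 <= #|A| ->
  exists (b : {ffun 'I_n -> 'I_L}) (e : bool),
    [/\ increasing b, forall x, b x \in A
      & forall x y : 'I_n, x < y -> lt_dir e (h (b x)) (h (b y))].
Proof.
move=> hinj n0 nA.
have /(chain_dichotomy hinj) : n.-1 * n.-1 < #|A| by nia.
rewrite prednK // => -[] [S [SA /increasing_into[b [bi bS]] mono]];
  [exists b, true|exists b, false]; split=> // [x|x y xy];
  by [apply: (fintype.subsetP SA) | apply: mono => //; apply: bi].
Qed.

(** * Settling one direction inside a dense set *)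

(** Heavy points are taken twice: once to find [L] values of the first
    coordinate over which [P] has density [1 / (2 a)], and once to find a
    proportion [1 / (4 a)] of the [q] that see at least [n ^ 2] of those values.
    The intermediate choice of only [L] values is what keeps the number of
    possible [b], and hence the loss of density, independent of [t]. *)
Lemma thin_direction disp (T : orderType disp) n t a (Q : finType)
    (h : 'I_t -> Q -> T) (P : {set 'I_t * Q}) :
  (forall q, injective (h^~ q)) -> 0 < n -> 0 < a -> 0 < #|Q| ->
  8 * a ^ 2 * n ^ 2 <= t -> t * #|Q| <= a * #|P| ->
  exists (b : {ffun 'I_n -> 'I_t}) (e : bool) (P' : {set Q}),
    [/\ increasing b, #|Q| <= 8 * a * (4 * a * n ^ 2) ^ n * #|P'|,
        forall q x, q \in P' -> (b x, q) \in P
      & forall q (x y : 'I_n), q \in P' -> x < y -> lt_dir e (h (b x) q) (h (b y) q)].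
Proof.
move=> hinj n0 a0 Q0 tbig dens.
(* [L / (4 a)] is the length [n ^ 2] that Erdős-Szekeres requires. *)
move LE : (4 * a * n ^ 2) => L.
have cP : #|P| = \sum_x #|[set q | (x, q) \in P]|.
  under eq_bigr do rewrite -sum1dep_card big_mkcond.
  rewrite pair_big /= -sum1_card big_mkcond /=.
  by apply: eq_bigr => -[x q] _ /=.
have : #|'I_t| * #|Q| <= a * \sum_x #|[set q | (x, q) \in P]| by rewrite card_ord -cP.
move=> /heavy_points -/(_ Q0 (fun=> max_card _)); rewrite card_ord.
set W := [set x | _] => tW.
have LW : L <= #|W|.
  have : 2 * a * L <= 2 * a * #|W| by apply: leq_trans tW; rewrite -LE; nia.
  by rewrite leq_pmul2l //; lia.
have [i [iincr iW]] := increasing_into LW.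
have L0 : 0 < L by rewrite -LE; nia.
pose sec q := [set u : 'I_L | (i u, q) \in P].
have : #|Q| * L <= (2 * a) * \sum_q #|sec q|.
  have -> : \sum_q #|sec q| = \sum_u #|[set q | (i u, q) \in P]|.
    under eq_bigr do rewrite -sum1dep_card big_mkcond.
    by rewrite exchange_big /=; apply: eq_bigr => u _; rewrite -sum1dep_card [RHS]big_mkcond.
  rewrite big_distrr /= mulnC -[L in L * _]card_ord -sum_nat_const.
  by apply: leq_sum => u _; have := iW u; rewrite inE.
have secL q : #|sec q| <= L by rewrite -[leqRHS]card_ord max_card.
move=> /heavy_points -/(_ L0 secL).
rewrite mulnA; set Q1 := [set q | _] => QQ1.
have ES q : exists c : {ffun 'I_n -> 'I_L} * bool, q \in Q1 ->
    [/\ increasing c.1, forall x, c.1 x \in sec q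
      & forall x y : 'I_n, x < y -> lt_dir c.2 (h (i (c.1 x)) q) (h (i (c.1 y)) q)].
  case: (boolP (q \in Q1)) => [|_]; last first.
    by exists ([ffun=> Ordinal L0], true).
  rewrite inE => qQ1.
  have big : n ^ 2 <= #|sec q|.
    have : 4 * a * n ^ 2 <= 4 * a * #|sec q| by lia.
    by rewrite leq_pmul2l //; lia.
  have uinj : injective (fun u => h (i u) q).
    move=> u v /hinj iuv; apply/val_inj/eqP; case: ltngtP => //.
      by move=> /iincr; rewrite iuv ltnn.
    by move=> /iincr; rewrite iuv ltnn.
  have [b [e [? ? ?]]] := erdos_szekeres uinj n0 big.
  by exists (b, e).
have [col colP] := choice ES.
have Q10 : 0 < #|Q1| by nia.
have [[g e] pop] := popular_colour col Q10.
set P' := [set _ in _ | _] in pop.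
have P'P q : q \in P' -> q \in Q1 /\ col q = (g, e).
  by rewrite inE => /andP[? /eqP].
have /card_gt0P[q0 /P'P[q0Q cq0]] : 0 < #|P'| by nia.
exists [ffun x => i (g x)], e, P'; split.
- move=> x y xy; rewrite !ffunE; apply: iincr.
  by have [+ _ _] := colP _ q0Q; rewrite cq0; apply.
- rewrite card_prod card_bool card_ffun !card_ord in pop.
  nia.
- move=> q x /P'P[/colP[_ + _] cq]; rewrite cq ffunE => /(_ x).
  by rewrite inE.
- move=> q x y /P'P[/colP[_ _ +] cq] xy; rewrite cq !ffunE => /(_ x y xy).
  by [].
Qed.

(** * Boxes of tuples and homogeneous functions *)

Definition emb d m N (s : d.-tuple {ffun 'I_m -> 'I_N}) (p : d.-tuple 'I_m) :
    d.-tuple 'I_N :=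
  [tuple tnth s i (tnth p i) | i < d].

Lemma emb_cons d m N (f : {ffun 'I_m -> 'I_N}) (s : d.-tuple {ffun 'I_m -> 'I_N}) x
    (p : d.-tuple 'I_m) :
  emb [tuple of f :: s] [tuple of x :: p] = [tuple of f x :: emb s p].
Proof.
apply: eq_from_tnth => i; rewrite tnth_mktuple.
by case: (unliftP ord0 i) => [j|] ->; rewrite ?tnthS ?tnth0 ?tnth_mktuple.
Qed.

Lemma increasing_inj m N (s : 'I_m -> 'I_N) : increasing s -> injective s.
Proof.
move=> si x y sxy; apply/val_inj/eqP; case: ltngtP => // /si; by rewrite sxy ltnn.
Qed.

Lemma emb_inj d m N (s : d.-tuple {ffun 'I_m -> 'I_N}) :
  (forall i, increasing (tnth s i)) -> injective (emb s).
Proof.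
move=> si p q spq; apply: eq_from_tnth => i; apply: (increasing_inj (si i)).
by have := congr1 (fun u => tnth u i) spq; rewrite !tnth_mktuple.
Qed.

Lemma cons_tuple_inj d (X : Type) (x y : X) (p q : d.-tuple X) :
  [tuple of x :: p] = [tuple of y :: q] -> x = y /\ p = q.
Proof. by move=> /(congr1 val) [-> /val_inj->]. Qed.

(** All the slices at the values of the first coordinate are order isomorphic,
    and each of them is homogeneous in turn; equivalently, comparing two points
    that agree in their first coordinates gives a result that does not depend on
    these common coordinates. *)
Fixpoint homogeneous disp (T : orderType disp) t d : (d.-tuple 'I_t -> T) -> Prop :=
  match d with
  | 0 => fun=> True
  | d'.+1 => fun F =>
      (forall x y (p q : d'.-tuple 'I_t),
         (F [tuple of x :: p] < F [tuple of x :: q])%O =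
         (F [tuple of y :: p] < F [tuple of y :: q])%O) /\
      forall x, homogeneous (fun p => F [tuple of x :: p])
  end.

Definition monotone_fun disp (T : orderType disp) m d (F : d.-tuple 'I_m -> T) : Prop :=
  forall i, exists e, forall p q : d.-tuple 'I_m,
    (forall j, j != i -> tnth p j = tnth q j) -> tnth p i < tnth q i ->
    lt_dir e (F p) (F q).

(** By homogeneity the first coordinate of an edge in another direction can be
    moved to [x0], so one monotone slice is enough. *)
Lemma monotone_fun_cons disp (T : orderType disp) m d (F : d.+1.-tuple 'I_m -> T) e (x0 : 'I_m) :
  (forall (x y : 'I_m) (p : d.-tuple 'I_m), x < y ->
     lt_dir e (F [tuple of x :: p]) (F [tuple of y :: p])) ->
  (forall x y (p q : d.-tuple 'I_m),
     (F [tuple of x :: p] < F [tuple of x :: q])%O =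
     (F [tuple of y :: p] < F [tuple of y :: q])%O) ->
  monotone_fun (fun p => F [tuple of x0 :: p]) -> monotone_fun F.
Proof.
move=> mono0 hom mono i; case: (unliftP ord0 i) => [i'|] ->.
  have [e' mono'] := mono i'; exists e' => p q.
  case/tupleP: p => x p; case/tupleP: q => y q pq; rewrite !tnthS => pqi.
  have := pq ord0 isT; rewrite !tnth0 => <-.
  have := mono' p q _ pqi; rewrite /lt_dir !(hom x x0); apply=> j ji.
  by have := pq (lift ord0 j); rewrite !tnthS; apply; rewrite (inj_eq lift_inj).
exists e => p q; case/tupleP: p => x p; case/tupleP: q => y q pq.
rewrite !tnth0 => xy; suff -> : p = q by apply: mono0.
apply: eq_from_tnth => j; have := pq (lift ord0 j); rewrite !tnthS; exact.
Qed.

Lemma homogeneous_ext disp (T : orderType disp) t d (F G : d.-tuple 'I_t -> T) :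
  F =1 G -> homogeneous F -> homogeneous G.
Proof. by move=> /funext->. Qed.

(** * Every large box contains a homogeneous box *)

Definition homogenizing_size t d := 2 ^ t ^ d.+1 ^ 2.

Lemma leq_homogenizing_sizeS t d : 1 < t ->
  homogenizing_size t d <= homogenizing_size t d.+1.
Proof. by move=> t1; rewrite leq_exp2l // leq_exp2l // leq_exp2r. Qed.

(** The second factor of the product is the number of colours in [homogenize]:
    a tuple of [d] maps from a [t]-set, and a binary relation on the points of
    a box of side [t]. *)
Lemma homogenizing_size_colours t d : 1 < t ->
  t * ((homogenizing_size t d ^ t) ^ d * 2 ^ (t ^ d * t ^ d)) <=
  homogenizing_size t d.+1.
Proof.
move=> t1; rewrite /homogenizing_size -!expnM -!expnD.
apply: (@leq_trans (2 ^ t * 2 ^ (t ^ d.+1 ^ 2 * (t * d) + t ^ (d + d)))).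
  by rewrite leq_mul ?(ltnW (ltn_expl _ _)) // -!mulnA.
rewrite -expnD leq_exp2l //.
have step k : k <= d ^ 2 + 3 * d + 2 -> t ^ k <= t ^ (d ^ 2 + 3 * d + 2).
  by move=> ?; rewrite leq_exp2l.
have h1 : t <= t ^ (d ^ 2 + 3 * d + 2) by rewrite -{1}(expn1 t) step //; lia.
have h2 : t ^ (d + d) <= t ^ (d ^ 2 + 3 * d + 2) by rewrite step //; lia.
have h3 : t ^ d.+1 ^ 2 * (t * d) <= t ^ (d ^ 2 + 3 * d + 2).
  apply: (@leq_trans (t ^ d.+1 ^ 2 * (t * t ^ d))).
    by rewrite !leq_mul // ltnW // ltn_expl.
  by rewrite -expnS -expnD step //; nia.
have h4 : 4 * t ^ (d ^ 2 + 3 * d + 2) <= t ^ d.+2 ^ 2.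
  apply: (@leq_trans (t ^ 2 * t ^ (d ^ 2 + 3 * d + 2))); first by rewrite leq_mul //; nia.
  by rewrite -expnD leq_exp2l //; nia.
lia.
Qed.

(** Colour each value of the first coordinate by the homogeneous subbox that
    the induction hypothesis finds in its slice, together with the order
    pattern of the slice there, and keep [t] values of the same colour.  The
    slices are first cut down to the size [M] for dimension [d]: the number of
    colours must not depend on [N]. *)
Lemma homogenize disp (T : orderType disp) t d N (F : d.-tuple 'I_N -> T) :
  1 < t -> homogenizing_size t d <= N ->
  exists s : d.-tuple {ffun 'I_t -> 'I_N},
    (forall i, increasing (tnth s i)) /\ homogeneous (fun p => F (emb s p)).
Proof.
move=> t1; elim: d N F => [|d IH] N F sN; first by exists [tuple]; split=> // -[].
set M := homogenizing_size t d in IH.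
have MN : M <= N by apply: leq_trans (leq_homogenizing_sizeS d t1) sN.
pose w := widen_ord MN.
have slice x : exists s : d.-tuple {ffun 'I_t -> 'I_M},
    (forall i, increasing (tnth s i)) /\
    homogeneous (fun p => F [tuple of x :: map_tuple w (emb s p)]).
  exact: (IH M (fun p => F [tuple of x :: map_tuple w p])).
have [S SP] := choice slice.
pose G x s (p : d.-tuple 'I_t) := F [tuple of x :: map_tuple w (emb s p)].
pose pattern x := [ffun pq : d.-tuple 'I_t * d.-tuple 'I_t =>
  (G x (S x) pq.1 < G x (S x) pq.2)%O].
have N0 : 0 < #|[set: 'I_N]|.
  by rewrite cardsT card_ord (leq_trans _ sN) // expn_gt0.
have [[s c]] := popular_colour (fun x => (S x, pattern x)) N0.
set A := [set _ in _ | _] => Abig.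
have tA : t <= #|A|.
  move: Abig; rewrite cardsT card_prod !card_ffun card_bool card_prod !card_tuple.
  rewrite card_ffun !card_ord => Abig.
  have := leq_trans (leq_trans (homogenizing_size_colours d t1) sN) Abig.
  by rewrite mulnC leq_pmul2l // muln_gt0 !expn_gt0.
have [b [bincr bA]] := increasing_into tA.
have Sb x : S (b x) = s /\ pattern (b x) = c.
  by have := bA x; rewrite inE => /andP[_ /eqP[-> ->]].
have t0 : 0 < t by lia.
pose s' := map_tuple (fun f : {ffun 'I_t -> 'I_M} => [ffun x => w (f x)]) s.
have emb_s' p : emb s' p = map_tuple w (emb s p).
  by apply: eq_from_tnth => i; rewrite !(tnth_mktuple, tnth_map) ffunE.
exists [tuple of b :: s']; split.
  move=> i; case: (unliftP ord0 i) => [j|] ->; rewrite ?tnth0 // tnthS tnth_map.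
  move=> x y xy; rewrite !ffunE /=.
  by have [+ _] := SP (b (Ordinal t0)); rewrite (Sb _).1; apply.
have FE (x : 'I_t) (p : d.-tuple 'I_t) : F (emb [tuple of b :: s'] [tuple of x :: p]) = G (b x) s p.
  by rewrite emb_cons emb_s'.
split=> [x y p q|x].
  rewrite !FE.
  have cE z : (G (b z) s p < G (b z) s q)%O = c (p, q).
    by have [Sz <-] := Sb z; rewrite ffunE Sz.
  by rewrite !cE.
apply: (@homogeneous_ext _ _ _ _ (G (b x) s)) => [p|]; first by rewrite FE.
by have [_] := SP (b x); rewrite (Sb x).1.
Qed.

(** * Every dense set in a homogeneous box contains a monotone box *)

(** The density of [P] is tracked as a power of [n].  One use of
    [thin_direction] turns the exponent [e] into at most [3 * n * e], since
    [8 a (4 a n^2)^n <= n^(3 + e + n (e + 4))] for [a = n^e], and it needs a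
    side of at least [8 a^2 n^2 <= n^(4 e)].  The last axis is reached with
    exponent [(3 n)^(d-1) * e], which explains the lower bound on [t]; in
    dimension 0 there is no axis and no lower bound. *)
Lemma monotone_in_dense disp (T : orderType disp) d n e t (F : d.-tuple 'I_t -> T)
    (P : {set d.-tuple 'I_t}) :
  1 < n -> 3 < e -> (0 < d -> n ^ (4 * e * (3 * n) ^ d.-1) <= t) ->
  injective F -> homogeneous F -> t ^ d <= n ^ e * #|P| ->
  exists b : d.-tuple {ffun 'I_n -> 'I_t},
    [/\ forall i, increasing (tnth b i), forall p, emb b p \in P
      & monotone_fun (fun p => F (emb b p))].
Proof.
move=> n1; elim: d e F P => [|d IH] e F P e3 tbig Finj homF dens.
  have /card_gt0P[p pP] : 0 < #|P| by move: dens; rewrite expn0 muln_gt0 => /andP[].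
  by exists [tuple]; split=> [[]//|q|[]//]; rewrite [emb _ _]tuple0 -(tuple0 p).
have {}tbig := tbig isT; rewrite /= in tbig.
have n0 : 0 < n by lia.
have t_ge : n ^ (4 * e) <= t.
  by apply: leq_trans tbig; rewrite leq_exp2l // leq_pmulr // expn_gt0 muln_gt0 n0.
have t0 : 0 < t by apply: leq_trans t_ge; rewrite expn_gt0 n0.
pose glue (xq : 'I_t * d.-tuple 'I_t) := [tuple of xq.1 :: xq.2].
have glue_inj : injective glue by move=> [x p] [y q] E; have [/= -> ->] := cons_tuple_inj E.
pose P1 := [set xq | glue xq \in P].
have cardP : #|P| = #|P1|.
  rewrite -(card_imset _ glue_inj); apply: eq_card => p.
  case/tupleP: p => x p; apply/idP/imsetP => [xpP|[xq + ->]]; last by rewrite inE.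
  by exists (x, p); rewrite ?inE.
have n2 : 8 <= n ^ 3 by nia.
have [|||||| b0 [e0 [P' [b0incr densP' inP mono0]]]] :=
  @thin_direction _ _ n t (n ^ e) {: d.-tuple 'I_t}
    (fun x (q : d.-tuple 'I_t) => F [tuple of x :: q]) P1.
- by move=> q x y /Finj E; have [] := cons_tuple_inj E.
- exact: n0.
- by rewrite expn_gt0 n0.
- by rewrite card_tuple card_ord expn_gt0 t0.
- apply: leq_trans t_ge; rewrite -expnM.
  apply: (@leq_trans (n ^ 3 * n ^ (e * 2) * n ^ 2)); first by rewrite !leq_mul.
  by rewrite -!expnD leq_exp2l //; lia.
- by rewrite card_tuple card_ord -expnS -cardP.
have x0 : 'I_n := Ordinal n0.
pose F' (p : d.-tuple 'I_t) := F [tuple of b0 x0 :: p].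
case: homF => homF0 homF.
have [||||| b [bincr bP' bmono]] := IH (3 * n * e) F' P'.
- nia.
- case: d {IH F P Finj dens glue glue_inj P1 cardP P'
    densP' inP mono0 homF0 homF F'} tbig => // d tbig _.
  apply: leq_trans tbig; rewrite leq_exp2l //= expnS; nia.
- by move=> p q /Finj E; have [] := cons_tuple_inj E.
- exact: homF.
- move: densP'; rewrite card_tuple card_ord => /leq_trans; apply.
  rewrite leq_mul2r; apply/orP; right.
  apply: (@leq_trans (n ^ 3 * n ^ e * (n ^ 2 * n ^ e * n ^ 2) ^ n)).
    by rewrite !leq_mul // leq_exp2r // !leq_mul // ; nia.
  rewrite -!expnD -expnM -!expnD leq_exp2l //; nia.
exists [tuple of b0 :: b]; split.
- by move=> i; case: (unliftP ord0 i) => [j|] ->; rewrite ?tnth0 ?tnthS.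
- move=> p; case/tupleP: p => x p; rewrite emb_cons.
  by have := inP _ x (bP' p); rewrite inE.
- apply: (@monotone_fun_cons _ _ _ _ _ e0 x0).
  + by move=> x y p xy; rewrite !emb_cons; apply: mono0.
  + by move=> x y p q; rewrite !emb_cons; apply: homF0.
  + by move=> i; have [e' m'] := bmono i; exists e' => p q pq pqi; rewrite !emb_cons; apply: m'.
Qed.

(** * The doubly exponential bound *)

Definition monotone_size d n := 2 ^ n ^ (16 * 3 ^ d.-1 * d.+1 ^ 2 * n ^ d.-1).

Lemma monotone_restriction disp (T : orderType disp) d n
    (F : d.-tuple 'I_(monotone_size d n) -> T) :
  0 < n -> 0 < d -> injective F ->
  exists b : d.-tuple {ffun 'I_n -> 'I_(monotone_size d n)},
    (forall i, increasing (tnth b i)) /\ monotone_fun (fun p => F (emb b p)).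
Proof.
rewrite leq_eqVlt => /orP[/eqP n1|n1] d0 Finj.
  (* One point per axis is enough; the general argument would start from a box
     of side [t = 1], which [homogenize] excludes. *)
  subst n; have N0 : 0 < monotone_size d 1 by rewrite expn_gt0.
  have no_lt (x y : 'I_1) : x < y = false by rewrite (ord1 x) (ord1 y).
  exists [tuple [ffun=> Ordinal N0] | i < d]; split=> [i x y|i].
    by rewrite no_lt.
  by exists true => p q _; rewrite no_lt.
pose t := n ^ (4 * 4 * (3 * n) ^ d.-1).
have n0 : 0 < n by lia.
have t1 : 1 < t.
  by rewrite (leq_trans n1) // -{1}(expn1 n) leq_exp2l // !muln_gt0 expn_gt0 muln_gt0 n0.
have [|s [sincr shom]] := homogenize F t1.
  rewrite /homogenizing_size /monotone_size -expnM leq_exp2l // leq_exp2l // expnMn.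
  by lia.
have [|||b [bincr _ bmono]] :=
  monotone_in_dense (P := [set: d.-tuple 'I_t]) n1 (isT : 3 < 4) _ _ shom.
- by [].
- by move=> p q /Finj /(emb_inj sincr).
- by rewrite cardsT card_tuple card_ord leq_pmull // expn_gt0 n0.
pose c := [tuple [ffun x => tnth s i (tnth b i x)] | i < d].
have embc p : emb c p = emb s (emb b p).
  by apply: eq_from_tnth => i; rewrite !tnth_mktuple ffunE.
exists c; split.
  by move=> i x y xy; rewrite tnth_mktuple !ffunE; apply: sincr; apply: bincr.
move=> i; have [e m] := bmono i; exists e => p q pq pqi.
by rewrite !embc; apply: m.
Qed.

Local Open Scope ring_scope.

(** Translates from tuples of ordinals, where points can be counted, to arrays
    on integer points: the value [k] of an ordinal stands for the integer
    [k + 1]. *)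
Lemma forces_monotone_of_restriction (R : realType) d n N :
  (0 < n)%N -> (0 < N)%N ->
  (forall F : d.-tuple 'I_N -> R, injective F ->
     exists b : d.-tuple {ffun 'I_n -> 'I_N},
       (forall i, increasing (tnth b i)) /\ monotone_fun (fun p => F (emb b p))) ->
  forces_monotone R d n N.
Proof.
move=> n0 N0 restr; split=> // f domf.
pose coord (k : 'I_N) : int := k.+1.
have coord_inj : injective coord by move=> x y [] /val_inj.
have coord_dom i k : array_dom f i (coord k).
  by rewrite domf /= /coord; have := ltn_ord k; lia.
pose pt (p : d.-tuple 'I_N) (i : 'I_d) := coord (tnth p i).
have pt_inj : injective pt.
  move=> p q pq; apply: eq_from_tnth => i; apply: coord_inj.
  exact: (congr1 (@^~ i) pq).
have [|b [bincr bmono]] := restr (fun p => f (pt p)).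
  by move=> p q /array_inj E; apply: pt_inj; apply: E; rewrite inE => i; apply: coord_dom.
pose c i (x : 'I_n) := coord (tnth b i x).
have c_inj i : injective (c i) by move=> x y /coord_inj /(increasing_inj (bincr i)).
have c_lt i (x y : 'I_n) : c i x < c i y -> (x < y)%N.
  move=> cxy; case: (ltngtP x y) => // [yx|/val_inj E].
    by have := bincr i _ _ yx; move: cxy; rewrite /c /coord; lia.
  by move: cxy; rewrite E ltxx.
pose dom i := range (c i).
have dom0 i : (dom i !=set0)%classic by exists (c i (Ordinal n0)), (Ordinal n0).
have dom_sub i : (dom i `<=` array_dom f i)%classic by move=> _ [x _ <-]; apply: coord_dom.
have f_inj : {in box dom &, injective f}.
  move=> x y; rewrite !inE => xd yd; apply: array_inj; rewrite inE => i; exact: dom_sub.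
exists (Array dom0 f_inj); split.
- by split=> //= x.
- move=> i /=; apply: card_eq_trans (inj_card_eq (in2W (@c_inj i))) _.
  suff <- : ([set (x : nat) | x in [set: 'I_n]] = `I_n)%classic.
    by apply: card_esym; apply: inj_card_eq => x y _ _; apply: val_inj.
  apply/seteqP; split=> [_ [x _ <-] /=|k /= kn]; first exact: ltn_ord.
  by exists (Ordinal kn).
move=> i; have [e mono] := bmono i.
have lines (a : 'I_d -> int) (x y : 'I_n) : (forall j, j != i -> dom j (a j)) ->
    c i x < c i y -> lt_dir e (f (dfwith a i (c i x))) (f (dfwith a i (c i y))).
  move=> ad xy.
  have /choice[u uP] : forall j, exists v : 'I_n, j != i -> c j v = a j.
    move=> j; case: (eqVneq j i) => [->|ji]; first by exists x.
    by have [v _ va] := ad j ji; exists v.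
  pose p z := [tuple if j == i then z else u j | j < d].
  have pE z : pt (emb b (p z)) = dfwith a i (c i z).
    apply/funext => j; rewrite /pt !tnth_mktuple.
    case: dfwithP => [|k ik]; first by rewrite eqxx.
    by rewrite (eq_sym k) (negbTE ik) -uP // eq_sym.
  rewrite -!pE; apply: mono => [j /negbTE ji|]; rewrite !tnth_mktuple ?ji //.
  by rewrite eqxx; apply: c_lt xy.
case: e mono lines => mono lines; [left|right] => a ad x y; rewrite !inE;
  by move=> [x' _ <-] [y' _ <-] xy; apply: lines.
Qed.

Lemma powR_nat (R : realType) (m k : nat) : m%:R `^ k%:R = (m ^ k)%:R :> R.
Proof. by rewrite powR_mulrn ?ler0n // natrX. Qed.

Unset Implicit Arguments.
Set Strict Implicit.

Theorem theorem1p4 (R : realType) (d : nat) (hd : (2 <= d)%N) :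
  exists C : R, 0 < C /\
    forall n : nat, (0 < n)%N ->
      exists N : nat, is_M R d n N /\
        N%:R <= 2 `^ (n%:R `^ (C * n%:R ^+ (d - 1))) :> R.
Proof.
have d0 : (0 < d)%N by lia.
exists (16 * 3 ^ d.-1 * d.+1 ^ 2)%N%:R; split.
  by rewrite ltr0n !muln_gt0 !expn_gt0.
move=> n n0.
have forces : forces_monotone R d n (monotone_size d n).
  apply: forces_monotone_of_restriction => //; first by rewrite expn_gt0.
  by move=> F; apply: monotone_restriction.
have exM : exists N, `[< forces_monotone R d n N >].
  by exists (monotone_size d n); apply/asboolP.
have [N /asboolP fN minN] := ex_minnP exM.
exists N; split; first by split=> // N' fN'; apply: minN; apply/asboolP.
rewrite subn1 -natrX -natrM !powR_nat ler_nat.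
by apply: minN; apply/asboolP.
Qed.
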